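(* For sample sizes $N\ge2$ there exists a set $\mathcal{R}_{\mathrm{app},N}\subset\mathcal{R}$ of axis-parallel rectangles, depending only on the empirical measure $F_N$ of $N$ i.i.d. locations drawn from $F$, such that: 1. For every $R\in\mathcal{R}$ with $F(R)\in\left[\frac{2\log N}{N},\frac18\right]$, the event that there exists $R'\in\mathcal{R}_{\mathrm{app},N}$ with $R'\subset R$ and $$F(R\,\triangle\,R')\le\frac98\,\frac{F(R)}{\sqrt{\lfloor\log_2(1/F(R))\rfloor}}$$ has probability converging to $1$ as $N\to\infty$, uniformly in such $R$ and in $F$; that is, the infimum of the probabilities of this event, over all continuous distributions $F$ on $\mathbf{R}^2$ with independent marginals and all $R\in\mathcal{R}$ with $F(R)\in[\frac{2\log N}{N},\frac18]$, converges to $1$ as $N\to\infty$. 2. $\#\mathcal{R}_{\mathrm{app},N}\le C'N\log^2N$ for a universal constant $C'$.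
   Context: $\mathcal{R}$ denotes the set of all axis-parallel rectangles in $\mathbf{R}^2$, i.e. sets $\{(u,v)\in\mathbf{R}^2: x\le u\le x',\ y\le v\le y'\}$ with $x,x',y,y'\in[-\infty,\infty]$, $x<x'$, $y<y'$. The locations are $N$ i.i.d. points in $\mathbf{R}^2$ with distribution $F$, where $F$ is continuous with independent marginals; $F_N$ is their empirical measure. ''Depending only on $F_N$'' means that $\mathcal{R}_{\mathrm{app},N}$ is constructed from $F_N$ (and $N$) without knowledge of $F$. $F(R)$ is the probability of $R$ under $F$, $\triangle$ is the symmetric difference, $\#$ is cardinality, $\log$ is the natural logarithm and $\log_2$ the base-2 logarithm. *)

(* Defs.v *)
From mathcomp Require Import all_boot all_order all_algebra.
From mathcomp Require Import finmap.
From mathcomp Require Import all_classical all_reals all_analysis.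

Set Implicit Arguments.
Unset Strict Implicit.
Unset Printing Implicit Defensive.

Import Order.TTheory GRing.Theory Num.Theory.
Import numFieldNormedType.Exports.

Local Open Scope classical_set_scope.
Local Open Scope ring_scope.

Notation plane R := (measurableTypeR R * measurableTypeR R)%type.

(* Sides may be infinite; only the bounds are extended reals, the rectangle is
   a subset of the plane. *)
Definition rect (R : realType) (x x' y y' : \bar R) : set (plane R) :=
  [set p | (x <= (p.1)%:E <= x')%E /\ (y <= (p.2)%:E <= y')%E].

Definition rectangles (R : realType) : set (set (plane R)) :=
  [set Q | exists x x' y y' : \bar R,
     [/\ (x < x')%E, (y < y')%E & Q = rect x x' y y']].

Definition joint_cdf (R : realType) (F : probability (plane R) R)
    (p : R * R) : R :=
  fine (F (`]-oo, p.1]%classic `*` `]-oo, p.2]%classic)).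

Definition independent_marginals (R : realType)
    (F : probability (plane R) R) : Prop :=
  forall A B : set (measurableTypeR R), measurable A -> measurable B ->
    F (A `*` B) = (F (A `*` setT) * F (setT `*` B))%E.

Definition admissible (R : realType) (F : probability (plane R) R) : Prop :=
  continuous (joint_cdf F) /\ independent_marginals F.

(* The product rule over the whole index set gives it for every subfamily, by
   taking the remaining sets to be the whole plane. *)
Definition iid_sample (R : realType) (F : probability (plane R) R)
    d (T : measurableType d) (P : probability T R) (N : nat)
    (X : 'I_N -> T -> plane R) : Prop :=
  [/\ forall i, measurable_fun setT (X i),
      forall i (A : set (plane R)), measurable A -> P (X i @^-1` A) = F A
    & forall A : 'I_N -> set (plane R), (forall i, measurable (A i)) ->
        P [set w | forall i, A i (X i w)] =
        (\prod_(i < N) P (X i @^-1` A i))%E].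

Definition empirical_measure (R : realType) (N : nat) (x : 'I_N -> plane R)
    (A : set (plane R)) : \bar R :=
  ((N%:R^-1)%:E * \sum_(i < N) \d_(x i) A)%E.

Definition log2 (R : realType) (x : R) : R := ln x / ln 2.

Definition well_approximated (R : realType) (F : probability (plane R) R)
    (Q : set (plane R)) (G : set (set (plane R))) : Prop :=
  exists Q' : set (plane R),
    [/\ G Q', Q' `<=` Q
      & (F (Q `+` Q') <=
          (9 / 8 * (fine (F Q) /
             Num.sqrt (Num.floor (log2 (1 / fine (F Q))))%:~R))%:E)%E].

Definition in_range (R : realType) (F : probability (plane R) R) (N : nat)
    (Q : set (plane R)) : Prop :=
  ((2 * ln N%:R / N%:R)%:E <= F Q <= (1 / 8)%:E)%E.

(* A family depending only on the empirical measure is a map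
   [app : nat -> (set (plane R) -> \bar R) -> set (set (plane R))] applied to
   the sample size and to the empirical measure. *)
Definition approx_event (R : realType) (F : probability (plane R) R)
    (app : nat -> (set (plane R) -> \bar R) -> set (set (plane R)))
    (N : nat) (Q : set (plane R)) (T : Type) (X : 'I_N -> T -> plane R) :
    set T :=
  [set w | well_approximated F Q (app N (empirical_measure (X ^~ w)))].

(* The underlying probability space varies as well, but the probability of the
   event is determined by [F], [Q] and [N]. *)
Definition approx_probabilities (R : realType)
    (app : nat -> (set (plane R) -> \bar R) -> set (set (plane R)))
    (N : nat) : set (\bar R) :=
  [set p | exists (F : probability (plane R) R) (Q : set (plane R))
     (d : measure_display) (T : measurableType d) (P : probability T R)
     (X : 'I_N -> T -> plane R),
     [/\ admissible F, rectangles Q, in_range F N Q, iid_sample F P X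
       & p = P (approx_event F app Q X)]].

(* Main.v *)
From HB Require Import structures.
Require Import Defs.
From mathcomp Require Import all_boot all_order all_algebra.
From mathcomp Require Import finmap.
From mathcomp Require Import all_classical all_reals all_analysis.
From mathcomp Require Import measurable_realfun.
From mathcomp Require Import ring lra zify.

Import Order.TTheory GRing.Theory Num.Theory.
Import numFieldNormedType.Exports.

Local Open Scope classical_set_scope.
Local Open Scope ring_scope.

(** The family is built on grids of order statistics. On each axis, the grid of
    level [j] keeps every [spacing N j]-th order statistic of that coordinate, so
    that two consecutive grid points enclose about [2 ^ (- j) / (16 s)] of the
    sample, where [s = scale N] has the order of the square root of [log N]. A
    rectangle of the family has its abscissas on the grid of some level [j] and
    its ordinates on the grid of some level [l], at most [64 s] grid steps apart
    on either axis; only pairs of levels with [2 ^ (j + l) * log_2 N <= N] occur.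

    Cardinality. On level [j] there are of the order of [2 ^ j * s] left ends and
    [s] lengths, hence [2 ^ (j + l) * s ^ 4] rectangles for the pair [(j, l)].
    Summing over [j + l <= depth N], where [2 ^ depth N * log_2 N <= N], leaves
    [depth N * 2 ^ depth N * s ^ 4], which is of the order of [N * (log N) ^ 2]
    ([size_rank_boxes]).

    Approximation. Let [Q] be the product of two intervals of marginal masses [w]
    and [h], and let [j] and [l] be the dyadic orders of magnitude of [w] and [h].
    The bound [F Q >= 2 log N / N] makes [(j, l)] a pair of levels that occurs. If
    every side of [Q] can be pushed inside by a marginal mass at most [w / (4 s)],
    resp. [h / (4 s)], so as to reach the grid, then the mass lost is at most
    [F Q / s] ([shrink_loss]), and [s ^ 2] dominates the logarithm of [1 / F Q].
    The rank of a fixed side of [Q] in the sample fluctuates by about the square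
    root of [N], much more than the spacing of the grid, but this is harmless:
    whatever this rank is, a strip containing [spacing N j] sample points contains
    a grid point ([bracket]). Hence only six counts matter, those of the strips of
    mass [w / (4 s)] or [h / (4 s)] along the four sides of [Q] and of its two
    projections. Their expectations are at least [log N / (2 s)], which tends to
    infinity, so that by the inequality of Chebyshev they are all within a factor
    2 of their expectations outside an event of probability at most
    [48 s / log N], uniformly in [F] and [Q] ([approx_event_off_small_set]).

    The approximation event is measurable because it is a finite union, over the
    possible ranks, of inequalities between continuous functions of order
    statistics ([measurable_approx_event]). The infimum of its probabilities is
    taken over a nonempty set, hence is at most 1, because the uniform distribution
    on the unit square has samples of every size
    ([approx_probabilities_unit_square]). *)

(** * Counts of sample points *)

Definition hits {T : Type} {N : nat} (x : 'I_N -> T) (A : set T) : nat :=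
  (\sum_(i < N) (x i \in A))%N.

(** Pairwise independence already determines the second moment of a count, and
    this second moment is all that is needed. *)
Lemma chebyshev_hits (R : realType) (d : measure_display)
    (T : measurableType d) (P : probability T R) (T' : Type) (N : nat)
    (X : 'I_N -> T -> T') (A : set T') (p t : R) :
  (forall i, measurable (X i @^-1` A)) ->
  (forall i, P (X i @^-1` A) = p%:E) ->
  (forall i k, i != k -> P (X i @^-1` A `&` X k @^-1` A) = (p ^+ 2)%:E) ->
  0 < t ->
  measurable [set w | t <= `|(hits (X ^~ w) A)%:R - N%:R * p|] /\
  (P [set w | (t <= `|(hits (X ^~ w) A)%:R - N%:R * p|)%R] <=
     (N%:R * p / t ^+ 2)%:E)%E.
Proof.
move=> mE PE PEE t0.
case: N X mE PE PEE => [|N] X mE PE PEE.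
  rewrite (_ : [set w | _] = set0) ?measure0 ?mulr0n ?mul0r//.
  by apply/seteqP; split=> // w /=; rewrite /hits big_ord0 mulr0n subr0 normr0 leNgt t0.
have p0 : 0 <= p by rewrite -lee_fin -(PE ord0).
pose E i := X i @^-1` A.
have mEi i : measurable (E i) by exact: mE.
have PEi i : P (E i) = p%:E by exact: PE.
have PEk i k : i != k -> P (E i `&` E k) = (p ^+ 2)%:E by exact: PEE.
have mEk i k : measurable (E i `&` E k) by apply: measurableI; exact: mE.
have SE w : (hits (X ^~ w) A)%:R = \sum_(i < N.+1) \1_(E i) w :> R.
  rewrite /hits natr_sum; apply: eq_bigr => i _.
  by rewrite indicE; congr (_%:R); congr nat_of_bool; apply/idP/idP; rewrite !inE.
pose c := N.+1%:R * p.
pose B := [set w | t <= `|(hits (X ^~ w) A)%:R - c|].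
have c0 : 0 <= c by rewrite mulr_ge0.
have mI i : measurable_fun setT (\1_(E i) : T -> R) by apply: measurable_indic; exact: mE.
have mB : measurable B.
  rewrite -[B]setTI.
  apply: (@measurable_fun_le _ _ _ _ (cst t) (fun w => `|(hits (X ^~ w) A)%:R - c|)) => //.
  under eq_fun do rewrite SE.
  apply: measurableT_comp => //; apply: measurable_funB => //.
  exact: measurable_sum.
split=> //.
have Pfin : P B \is a fin_num by exact: fin_num_measure.
(* The square is expanded with its cross term moved to the left, so that both
   integrands are nonnegative. *)
have key : (\int[P]_w ((t ^+ 2 * \1_B w)%:E + \sum_(i < N.+1) (2 * c * \1_(E i) w)%:E) <=
  \int[P]_w ((c ^+ 2)%:E + \sum_(i < N.+1) \sum_(k < N.+1) (\1_(E i `&` E k) w)%:E))%E.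
  apply: ge0_le_integral => //=.
  - move=> w _; apply: adde_ge0; first by rewrite lee_fin mulr_ge0 ?sqr_ge0.
    by apply: sume_ge0 => i _; rewrite lee_fin !mulr_ge0.
  - apply: emeasurable_funD; first by apply/measurable_EFinP; exact: measurable_funM.
    by apply: emeasurable_sum => i; apply/measurable_EFinP; exact: measurable_funM.
  - apply: emeasurable_funD => //.
    apply: emeasurable_sum => i; apply: emeasurable_sum => k.
    apply/measurable_EFinP; apply: measurable_indic.
    exact: mEk.
  - move=> w _; rewrite !sumEFin.
    under [in leRHS]eq_bigr do rewrite sumEFin.
    rewrite sumEFin -!EFinD lee_fin.
    rewrite -mulr_sumr -SE.
    have -> : \sum_(i < N.+1) \sum_(k < N.+1) \1_(E i `&` E k) w = (hits (X ^~ w) A)%:R ^+ 2 :> R.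
      rewrite expr2 SE mulr_suml; apply: eq_bigr => i _.
      by rewrite mulr_sumr; apply: eq_bigr => k _; rewrite indicI.
    rewrite indicE; case: (boolP (w \in B)); last by move=> _; rewrite mulr0n mulr0; have := sqr_ge0 ((hits (X^~ w) A)%:R - c); lra.
    rewrite inE /B /= => h.
    have : t ^+ 2 <= `|(hits (X^~ w) A)%:R - c| ^+ 2.
      by rewrite lerXn2r// nnegrE ltW.
    rewrite mulr1n mulr1 real_normK ?num_real//; lra.
move: key.
rewrite ge0_integralD//=; last first.
- by apply: emeasurable_sum => i; apply/measurable_EFinP; exact: measurable_funM.
- by move=> w _; apply: sume_ge0 => i _; rewrite lee_fin !mulr_ge0.
- by apply/measurable_EFinP; exact: measurable_funM.
- by move=> w _; rewrite lee_fin mulr_ge0 ?sqr_ge0.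
rewrite ge0_integralD//=; last first.
- apply: emeasurable_sum => i; apply: emeasurable_sum => k.
  by apply/measurable_EFinP; apply: measurable_indic; exact: mEk.
- by move=> w _; apply: sume_ge0 => i _; apply: sume_ge0 => k _; rewrite lee_fin.
- by move=> w _; rewrite lee_fin sqr_ge0.
rewrite integral_cst//= probability_setT mule1.
rewrite ge0_integral_sum//=; last 2 first.
- by move=> i; apply/measurable_EFinP; exact: measurable_funM.
- by move=> i w _; rewrite lee_fin !mulr_ge0.
rewrite ge0_integral_sum//=; last 2 first.
- move=> i; apply: emeasurable_sum => k.
  by apply/measurable_EFinP; apply: measurable_indic; exact: mEk.
- by move=> i w _; apply: sume_ge0 => k _; rewrite lee_fin.
have -> : (\int[P]_w (t ^+ 2 * \1_B w)%:E = (t ^+ 2 * fine (P B))%:E)%E.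
  under eq_integral do rewrite EFinM.
  rewrite ge0_integralZl//= ?lee_fin ?sqr_ge0//; last exact/measurable_EFinP.
  by rewrite integral_indic// setIT [RHS]EFinM fineK.
have -> : (\sum_(i < N.+1) \int[P]_w (2 * c * \1_(E i) w)%:E = (2 * c * c)%:E)%E.
  rewrite (eq_bigr (fun=> (2 * c * p)%:E)); last first.
    move=> i _; under eq_integral do rewrite EFinM.
    rewrite ge0_integralZl//= ?lee_fin ?mulr_ge0//; last exact/measurable_EFinP.
    by rewrite integral_indic// setIT [RHS]EFinM; congr (_ * _)%E; exact: PEi.
  by rewrite sumEFin big_const_ord iter_addr addr0 -mulr_natl /c; congr EFin; ring.
have -> : (\sum_(i < N.+1) \int[P]_w (\sum_(k < N.+1) (\1_(E i `&` E k) w)%:E) =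
   (c + N.+1%:R * (N%:R * p ^+ 2))%:E)%E.
  rewrite (eq_bigr (fun=> (p + N%:R * p ^+ 2)%:E)); last first.
    move=> i _; rewrite ge0_integral_sum//=; last first.
      by move=> k; apply/measurable_EFinP; apply: measurable_indic; exact: mEk.
    rewrite (bigD1 i)//= integral_indic// setIT setIid EFinD.
    congr (_ + _)%E; first exact: PEi.
    rewrite (eq_bigr (fun=> (p ^+ 2)%:E)); last first.
      move=> k ki; rewrite integral_indic// setIT.
      by apply: PEk; rewrite eq_sym.
    by rewrite sumEFin sumr_const cardC1 card_ord mulr_natl.
  by rewrite sumEFin big_const_ord iter_addr addr0 -mulr_natl /c; congr EFin; ring.
rewrite -!EFinD lee_fin => key.
rewrite -/c -/B -(fineK Pfin) lee_fin ler_pdivlMr ?exprn_gt0//.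
have : N.+1%:R * (N%:R * p ^+ 2) <= c ^+ 2.
  by rewrite /c -natr1; have := sqr_ge0 p; have := ler0n R N; nra.
nra.
Qed.

Lemma iid_preimage_pair (R : realType) (F : probability (plane R) R)
    (d : measure_display) (T : measurableType d) (P : probability T R) (N : nat)
    (X : 'I_N -> T -> plane R) (A : set (plane R)) (p : R) :
  iid_sample F P X -> measurable A -> F A = p%:E ->
  forall i k, i != k -> P (X i @^-1` A `&` X k @^-1` A) = (p ^+ 2)%:E.
Proof.
move=> [_ XF XI] mA FA i k ik.
pose B (j : 'I_N) := if (j == i) || (j == k) then A else setT.
have mB j : measurable (B j) by rewrite /B; case: ifP.
have := XI B mB.
rewrite (bigD1 i)//= (bigD1 k)/=; last by rewrite eq_sym.
rewrite big1 => [|j /andP[ji jk]]; last first.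
  by rewrite XF// /B (negbTE ji) (negbTE jk) probability_setT.
rewrite !XF// /B !eqxx orbT /= FA mule1 -EFinM -expr2 => <-.
congr (P _); apply/seteqP; split=> w /=.
  by move=> [Ai Ak] j; case: ifP => // /orP[]/eqP ->.
by move=> h; split; [have := h i|have := h k]; rewrite eqxx ?orbT.
Qed.

(** The deviation is taken to be half of the expectation: a factor 2 is all the
    accuracy that the comparison with the grid requires. *)
Lemma iid_concentration (R : realType) (F : probability (plane R) R)
    (d : measure_display) (T : measurableType d) (P : probability T R) (N : nat)
    (X : 'I_N -> T -> plane R) (A : set (plane R)) (p : R) :
  iid_sample F P X -> measurable A -> F A = p%:E -> 0 < N%:R * p ->
  exists B : set T, [/\ measurable B, (P B <= (4 / (N%:R * p))%:E)%E &
    forall w, ~ B w ->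
      N%:R * p / 2 < (hits (X ^~ w) A)%:R < 2 * (N%:R * p)].
Proof.
move=> iid mA FA Np0; have [mX XF _] := iid.
have mE i : measurable (X i @^-1` A) by rewrite -[_ @^-1` _]setTI; exact: mX.
have [] := @chebyshev_hits R d T P _ N X A p (N%:R * p / 2) mE.
- by move=> i; rewrite XF.
- exact: iid_preimage_pair iid mA FA.
- lra.
move=> mB PB; exists [set w | N%:R * p / 2 <= `|(hits (X ^~ w) A)%:R - N%:R * p|].
split=> // [|w /= /negP].
  apply: le_trans PB _; rewrite lee_fin le_eqVlt; apply/orP; left; apply/eqP.
  have /norP[N0 p0] : ~~ ((N%:R == 0 :> R) || (p == 0)).
    by rewrite -mulf_eq0 gt_eqF.
  by field; rewrite N0 p0.
by rewrite -ltNge ltr_norml => /andP[h1 h2]; apply/andP; split; lra.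
Qed.

(** * Order statistics of a coordinate *)

(** The bound is extended so that infinite sides of rectangles are covered. *)
Definition below {R : realType} {T : Type} (pi : T -> R) (t : \bar R) : set T :=
  [set p | ((pi p)%:E <= t)%E].

(** For [0 < r <= N] this is the order statistic of rank [r] of the coordinate
    [pi], recovered from the empirical measure alone; for the other ranks it is
    the default value of [inf]. *)
Definition quantile {R : realType} (pi : plane R -> R) (N : nat)
    (mu : set (plane R) -> \bar R) (r : nat) : R :=
  inf [set t : R | ((r%:R / N%:R)%:E <= mu (below pi t%:E))%E].

Lemma empirical_hits (R : realType) (N : nat) (x : 'I_N -> plane R) A :
  empirical_measure x A = ((hits x A)%:R / N%:R)%:E.
Proof.
rewrite /empirical_measure /hits natr_sum mulrC EFinM -sumEFin.
by congr (_ * _)%E; apply: eq_bigr => i _; rewrite diracE.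
Qed.

Lemma hits_subset (T : Type) (N : nat) (x : 'I_N -> T) (A B : set T) :
  (forall i, A (x i) -> B (x i)) -> (hits x A <= hits x B)%N.
Proof.
move=> AB; apply: leq_sum => i _.
by case: (boolP (x i \in A)) => //; rewrite inE => /AB Bx; rewrite mem_set.
Qed.

Lemma hits_le_size (T : Type) (N : nat) (x : 'I_N -> T) (A : set T) :
  (hits x A <= N)%N.
Proof.
rewrite -[leqRHS]card_ord -sum1_card; apply: leq_sum => i _.
exact: leq_b1.
Qed.

Lemma hits_disjointU (T : Type) (N : nat) (x : 'I_N -> T) (A B : set T) :
  A `&` B = set0 -> hits x (A `|` B) = (hits x A + hits x B)%N.
Proof.
move=> AB0; rewrite /hits -big_split; apply: eq_bigr => i _ /=.
rewrite in_setU; case: (boolP (x i \in A)) => //; rewrite inE => Ai.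
rewrite memNset// => Bi.
by have : (A `&` B) (x i) by []; rewrite AB0.
Qed.

(** The infimum is attained at a sample point, namely the least one with at least
    [r] sample points at or below it. *)
Lemma quantileP (R : realType) (pi : plane R -> R) (N : nat)
    (x : 'I_N -> plane R) (r : nat) (t : R) : (0 < r <= N)%N ->
  (quantile pi N (empirical_measure x) r <= t) =
  (r <= hits x (below pi t%:E))%N.
Proof.
case/andP=> r0 rN; have N0 : (0 < N)%N by exact: leq_trans rN.
have qE : [set t : R | ((r%:R / N%:R)%:E <= empirical_measure x (below pi t%:E))%E] =
    [set t : R | (r <= hits x (below pi t%:E))%N].
  apply/seteqP; split=> u /=;
  by rewrite empirical_hits lee_fin ler_pM2r ?invr_gt0 ?ltr0n// ler_nat.
rewrite /quantile qE.
(* The greatest sample point has rank at least [r], so the least sample point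
   with this property exists. *)
pose Q u := (r <= hits x (below pi (u : R)%:E))%N.
have Qmono u v : u <= v -> Q u -> Q v.
  move=> uv /leq_trans; apply; apply: hits_subset => i /=; rewrite /below/= !lee_fin.
  by move=> /le_trans; apply.
pose i0 : 'I_N := Ordinal N0.
have Qmax : Q (pi (x [arg max_(i > i0) pi (x i)]%O)).
  case: arg_maxP => // i _ imax.
  apply: leq_trans rN _; rewrite -[leqLHS]card_ord -sum1_card.
  by apply: leq_sum => j _; rewrite mem_set// /below/= lee_fin; exact: imax.
case: (@arg_minP _ _ _ [arg max_(i > i0) pi (x i)]%O (fun i => Q (pi (x i)))
  (fun i => pi (x i)) Qmax) => m Qm mmin.
have QE u : Q u = (pi (x m) <= u).
  apply/idP/idP => [Qu|mu]; last exact: Qmono Qm.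
  have [i xiu] : exists i, pi (x i) <= u.
    apply: contrapT => /forallNP h; move: Qu; rewrite /Q leqNgt => /negP; apply.
    rewrite /hits big1 => [//|i _]; rewrite memNset// /below/= lee_fin.
    exact: h.
  case: (@arg_maxP _ _ _ i (fun i => pi (x i) <= u) (fun i => pi (x i)) xiu) => j ju jmax.
  apply: le_trans ju; apply: mmin; apply: leq_trans Qu _.
  by apply: hits_subset => k; rewrite /below/= !lee_fin => /jmax.
have -> : [set t : R | (r <= hits x (below pi t%:E))%N] = `[pi (x m), +oo[%classic.
  by apply/seteqP; split=> u /=; rewrite in_itv/= andbT -QE.
by rewrite inf_itv// -QE.
Qed.

Lemma below_mono (R : realType) (T : Type) (pi : T -> R) (s t : \bar R) :
  (s <= t)%E -> below pi s `<=` below pi t.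
Proof. by move=> st p; rewrite /below/= => /le_trans; apply. Qed.

Lemma hits_below_mono (R : realType) (T : Type) (pi : T -> R) N (x : 'I_N -> T)
  (s t : \bar R) : (s <= t)%E -> (hits x (below pi s) <= hits x (below pi t))%N.
Proof. by move=> st; apply: hits_subset => i; exact: below_mono. Qed.

Lemma hits_slab (R : realType) (T : Type) (pi : T -> R) N (x : 'I_N -> T)
  (s t : \bar R) : (s <= t)%E ->
  hits x (below pi t) =
  (hits x (below pi s) + hits x [set p | (s < (pi p)%:E <= t)%E])%N.
Proof.
move=> st; rewrite -hits_disjointU; last first.
  apply/seteqP; split=> // p [] /=; rewrite /below/= => h /andP[]; by rewrite ltNge h.
congr (hits x _); apply/seteqP; split=> p; rewrite /below/= => h.
  by case: (leP (pi p)%:E s) => ps; [left|right; apply/andP].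
by case: h => [/le_trans|/andP[_]//]; apply.
Qed.

(** Among [k] consecutive ranks one is a multiple of [k]. Hence a strip with at
    least [k] sample points contains an order statistic whose rank is a multiple of
    [k], wherever the ranks of the strip happen to lie; the number of points of the
    whole interval bounds the number of steps between two of them. *)
Lemma bracket (R : realType) (pi : plane R -> R) (N : nat)
    (x : 'I_N -> plane R) (k K : nat) (a b : \bar R) (z z' : R) :
  let C t := hits x (below pi t) in
  (0 < k)%N -> z <= z' ->
  (C a + k <= C z%:E)%N -> (C z'%:E + k <= C b)%N -> (C b <= C a + K * k)%N ->
  let q r := quantile pi N (empirical_measure x) r in
  exists i e : nat, [/\ (i * k <= N)%N, (e <= K)%N,
    (a <= (q (i * k)%N)%:E)%E /\ q (i * k)%N <= z &
    z' <= q ((i + e) * k)%N /\ ((q ((i + e) * k)%N)%:E <= b)%E].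
Proof.
move=> C k0 zz' az zb ab q.
have Czz' : (C z%:E <= C z'%:E)%N by apply: hits_below_mono; rewrite lee_fin.
have CN t : (C t <= N)%N by exact: hits_le_size.
(* The first multiple of [k] above [C a] and the last one up to [C b]. *)
pose i := (C a %/ k).+1; pose i' := (C b %/ k)%N.
have ai : (C a < i * k)%N by rewrite /i mulSn addnC; have := ltn_ceil (C a) k0; lia.
have ia : (i * k <= C a + k)%N by rewrite /i mulSn; have := leq_trunc_div (C a) k; lia.
have bi : (i' * k <= C b)%N by exact: leq_trunc_div.
have ib : (C b < i' * k + k)%N by have := ltn_ceil (C b) k0; rewrite mulSn /i'; lia.
have ii' : (i <= i')%N.
  by rewrite -(leq_pmul2r k0); lia.
exists i, (i' - i)%N; rewrite subnKC//.
have rk : (0 < i * k <= N)%N by have := CN z%:E; lia.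
have rk' : (0 < i' * k <= N)%N.
  have : (i * k <= i' * k)%N by rewrite leq_pmul2r.
  by have := CN b; lia.
split.
- by case/andP: rk.
- by rewrite -(leq_pmul2r k0) mulnBl; lia.
- split; last by rewrite quantileP//; rewrite -/(C _); lia.
  rewrite leNgt; apply/negP => sa.
  have : (i * k <= C (q (i * k)%N)%:E)%N by rewrite /C -quantileP// lexx.
  have : (C (q (i * k)%N)%:E <= C a)%N by apply: hits_below_mono; exact: ltW.
  lia.
- split.
    rewrite leNgt; apply/negP => sz.
    have : (i' * k <= C z'%:E)%N by rewrite /C -quantileP// ltW.
    lia.
  case: b zb ab @i' bi ib ii' rk' => [b| |] zb ab i' bi ib ii' rk'.
  + by rewrite lee_fin quantileP.
  + by rewrite leey.
  + have : C -oo%E = 0%N.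
      by rewrite /C /hits big1// => j _; rewrite memNset// /below/= leeNy_eq.
    lia.
Qed.

(** * Distribution function of a coordinate *)

Definition mcdf {R : realType} {d} {T : measurableType d} (P : probability T R)
  (pi : T -> R) (t : \bar R) : R := fine (P (below pi t)).

Section mcdf.
Context {R : realType} {d} {T : measurableType d} (P : probability T R).
Variable pi : T -> R.
Hypothesis mpi : measurable_fun setT pi.

Lemma measurable_below (t : \bar R) : measurable (below pi t).
Proof.
rewrite -[below _ _]setTI; apply: emeasurable_fun_le => //.
exact/measurable_EFinP.
Qed.

Lemma mcdfE (t : \bar R) : P (below pi t) = (mcdf P pi t)%:E.
Proof. by rewrite /mcdf fineK// fin_num_measure//; exact: measurable_below. Qed.

Lemma mcdf_mono (s t : \bar R) : (s <= t)%E -> mcdf P pi s <= mcdf P pi t.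
Proof.
move=> st; rewrite -lee_fin -!mcdfE le_measure ?inE//; try exact: measurable_below.
exact: below_mono.
Qed.

Lemma mcdfNy : mcdf P pi -oo%E = 0.
Proof.
rewrite /mcdf (_ : below pi _ = set0) ?measure0//.
by apply/seteqP; split=> // p; rewrite /below/= leeNy_eq.
Qed.

Lemma mcdfy : mcdf P pi +oo%E = 1.
Proof.
rewrite /mcdf (_ : below pi _ = setT) ?probability_setT//.
by apply/seteqP; split=> // p _; rewrite /below/= leey.
Qed.

Lemma slab_oc (s t : \bar R) : (s <= t)%E ->
  measurable [set p | (s < (pi p)%:E <= t)%E] /\
  P [set p | (s < (pi p)%:E <= t)%E] = (mcdf P pi t - mcdf P pi s)%:E.
Proof.
move=> st.
have -> : [set p | (s < (pi p)%:E <= t)%E] = below pi t `\` below pi s.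
  apply/seteqP; split=> p; rewrite /below/=.
    by move=> /andP[sp pt]; split=> //; apply/negP; rewrite -ltNge.
  by case=> pt /negP; rewrite -ltNge => sp; apply/andP.
split; first by apply: measurableD; exact: measurable_below.
rewrite measureD//; [|exact: measurable_below..|]; last first.
  by rewrite -ge0_fin_numE// fin_num_measure//; exact: measurable_below.
rewrite setIidr; last exact: below_mono.
by rewrite EFinB; congr (_ - _)%E; exact: mcdfE.
Qed.

(** Used with [v > 0], before the continuity of the distribution function is
    known, to find a point where it does not vanish. *)
Lemma mcdf_large (v : R) : v < 1 -> exists b : R, v <= mcdf P pi b%:E.
Proof.
move=> v1.
pose X : {mfun T >-> R} := HB.pack pi (isMeasurableFun.Build _ _ _ _ pi mpi).
have GE t : cdf (X : {RV P >-> R}) t = (mcdf P pi t%:E)%:E.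
  by rewrite -mcdfE (_ : below pi t%:E = pi @^-1` `]-oo, t]%classic).
have /fine_cvg := cvg_cdfy1 (X : {RV P >-> R}).
move=> /cvgrPdist_lt /(_ (1 - v)) []; first by rewrite subr_gt0.
move=> b [_ /(_ (b + 1))]; rewrite ltrDl ltr01 => /(_ isT) /=.
rewrite GE/= => /ltr_normlW h; exists (b + 1); lra.
Qed.

Lemma mcdf_small (v : R) : 0 < v -> exists a : R, mcdf P pi a%:E <= v.
Proof.
move=> v0.
pose X : {mfun T >-> R} := HB.pack pi (isMeasurableFun.Build _ _ _ _ pi mpi).
have GE t : cdf (X : {RV P >-> R}) t = (mcdf P pi t%:E)%:E.
  by rewrite -mcdfE (_ : below pi t%:E = pi @^-1` `]-oo, t]%classic).
have /fine_cvg := cvg_cdfNy0 (X : {RV P >-> R}).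
move=> /cvgrPdist_lt /(_ v) []; first by [].
move=> a [_ /(_ (a - 1))]; rewrite gtrBl ltr01 => /(_ isT) /=.
rewrite GE/= sub0r normrN => /ltr_normlW h; exists (a - 1); lra.
Qed.

Hypothesis cG : continuous (fun t : R => mcdf P pi t%:E).

(** The atom at [a] is contained in strips [(a - r / 2, a]], whose masses are
    increments of the distribution function. *)
Lemma level_set0 (a : R) : measurable [set p | pi p = a] /\ P [set p | pi p = a] = 0%E.
Proof.
have mE : measurable [set p | pi p = a].
  rewrite (_ : [set p | _] = [set p | a <= pi p] `&` [set p | pi p <= a]).
    by apply: measurableI; rewrite -[[set p | _]]setTI; apply: measurable_fun_le.
  apply/seteqP; split=> p /=; first by move=> ->; rewrite lexx.
  by move=> [h1 h2]; apply/eqP; rewrite eq_le h1 h2.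
split=> //; apply/eqP; rewrite eq_le measure_ge0 andbT.
apply/lee_addgt0Pr => e e0; rewrite add0e.
have /cvgrPdist_lt /(_ e e0) := cG a.
move=> /nbhs_ballP[r /= r0 H].
have := H (a - r / 2); rewrite /ball/= opprB addrCA subrr addr0.
rewrite gtr0_norm ?divr_gt0// => /(_ _)/ltW h.
have ar : ((a - r / 2)%:E <= a%:E)%E by rewrite lee_fin gerBl divr_ge0// ltW.
have [mS PS] := slab_oc _ _ ar.
apply: (@le_trans _ _ (P [set p | ((a - r / 2)%:E < (pi p)%:E <= a%:E)%E])).
  by rewrite le_measure ?inE// => p /= ->; rewrite lte_fin lexx gtrBl divr_gt0.
rewrite PS lee_fin; apply: le_trans (ler_norm _) (h _).
by rewrite ltr_pdivrMr// ltr_pMr// ltr1n.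
Qed.

Lemma slab_cc (s t : \bar R) : (s <= t)%E ->
  measurable [set p | (s <= (pi p)%:E <= t)%E] /\
  P [set p | (s <= (pi p)%:E <= t)%E] = (mcdf P pi t - mcdf P pi s)%:E.
Proof.
move=> st; have [mS PS] := slab_oc _ _ st.
have [m1 P1] : measurable [set p | (pi p)%:E = s] /\ P [set p | (pi p)%:E = s] = 0%E.
  case: s {st mS PS} => [s| |].
  - rewrite (_ : [set p | _] = [set p | pi p = s]); first exact: level_set0.
    by apply/seteqP; split=> p /= => [[]|->].
  - by rewrite (_ : [set p | _] = set0)//; apply/seteqP; split.
  - by rewrite (_ : [set p | _] = set0)//; apply/seteqP; split.
have mC : measurable [set p | (s <= (pi p)%:E <= t)%E].
  rewrite (_ : [set p | _] = [set p | (s <= (pi p)%:E)%E] `&` below pi t).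
    apply: measurableI; last exact: measurable_below.
    rewrite -[[set p | _]]setTI; apply: emeasurable_fun_le => //.
    exact/measurable_EFinP.
  by apply/seteqP; split=> p; rewrite /below/= => /andP.
split=> //; rewrite -PS; apply/eqP; rewrite eq_le; apply/andP; split; last first.
  by rewrite le_measure ?inE// => p /= /andP[/ltW -> ->].
rewrite -[leRHS]adde0 -P1 -measureU//; last first.
  by apply/seteqP; split=> // p /= [/andP[sp _] ps]; move: sp; rewrite ps ltxx.
rewrite le_measure ?inE//; first exact: measurableU.
move=> p /= /andP[sp pt]; move: sp; rewrite le_eqVlt => /orP[/eqP ->|sp]; first by right.
by left; apply/andP.
Qed.

Lemma mcdf_surj (v : R) : 0 < v < 1 -> exists z : R, mcdf P pi z%:E = v.
Proof.
move=> /andP[v0 v1].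
have [b vb] := mcdf_large _ v1.
have [a va] := mcdf_small _ v0.
have [ab|/ltW ba] := leP a b.
  have [||z _ zE] := @IVT R (fun t => mcdf P pi t%:E) a b v ab; last by exists z.
  - exact: continuous_subspaceT.
  - by rewrite ge_min le_max va vb orbT.
exists a; apply/eqP; rewrite eq_le va/=; apply: le_trans vb _.
by apply: mcdf_mono; rewrite lee_fin.
Qed.

End mcdf.

(** * Rectangles under independent marginals *)

Definition ax1 {R : realType} : plane R -> R := fst.
Definition ax2 {R : realType} : plane R -> R := snd.

Lemma measurable_ax1 (R : realType) : measurable_fun setT (@ax1 R).
Proof. exact: measurable_fst. Qed.

Lemma measurable_ax2 (R : realType) : measurable_fun setT (@ax2 R).
Proof. exact: measurable_snd. Qed.

Lemma joint_cdf_prod (R : realType) (F : probability (plane R) R) (s t : R) :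
  independent_marginals F ->
  joint_cdf F (s, t) = mcdf F ax1 s%:E * mcdf F ax2 t%:E.
Proof.
move=> ind; rewrite /joint_cdf/= ind//.
rewrite (_ : _ `*` setT = below ax1 s%:E); last first.
  by apply/seteqP; split=> p; rewrite /below/= in_itv/= lee_fin// => -[].
rewrite (_ : setT `*` _ = below ax2 t%:E); last first.
  by apply/seteqP; split=> p; rewrite /below/= in_itv/= lee_fin// => -[].
rewrite (mcdfE F _ (measurable_ax1 R)) (mcdfE F _ (measurable_ax2 R)).
by rewrite -EFinM.
Qed.

(** By independence the joint distribution function along a horizontal line is a
    multiple of the first marginal one, and the multiple is nonzero on a high
    enough line. *)
Lemma continuous_mcdf1 (R : realType) (F : probability (plane R) R) :
  admissible F -> continuous (fun t : R => mcdf F ax1 t%:E).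
Proof.
move=> [cF ind].
have [b b0] : exists b : R, 1 / 2 <= mcdf F ax2 b%:E.
  by apply: mcdf_large; [exact: measurable_ax2|lra].
have -> : (fun t : R => mcdf F ax1 t%:E) =
    (fun t => joint_cdf F (t, b) * (mcdf F ax2 b%:E)^-1).
  apply/funext => t; rewrite joint_cdf_prod// mulfK//.
  by rewrite gt_eqF//; lra.
move=> t; apply: cvgM; last exact: cvg_cst.
apply: (@continuous_comp _ _ _ (fun t : R => (t, b)) (joint_cdf F)); last exact: cF.
by apply: (@cvg_pair _ _ _ (nbhs t) (nbhs t) (nbhs b)); [exact: cvg_id|exact: cvg_cst].
Qed.

Lemma continuous_mcdf2 (R : realType) (F : probability (plane R) R) :
  admissible F -> continuous (fun t : R => mcdf F ax2 t%:E).
Proof.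
move=> [cF ind].
have [b b0] : exists b : R, 1 / 2 <= mcdf F ax1 b%:E.
  by apply: mcdf_large; [exact: measurable_ax1|lra].
have -> : (fun t : R => mcdf F ax2 t%:E) =
    (fun t => joint_cdf F (b, t) * (mcdf F ax1 b%:E)^-1).
  apply/funext => t; rewrite joint_cdf_prod// mulrAC mulfV ?mul1r//.
  by rewrite gt_eqF//; lra.
move=> t; apply: cvgM; last exact: cvg_cst.
apply: (@continuous_comp _ _ _ (fun t : R => (b, t)) (joint_cdf F)); last exact: cF.
by apply: (@cvg_pair _ _ _ (nbhs t) (nbhs b) (nbhs t)); [exact: cvg_cst|exact: cvg_id].
Qed.

(** Without atoms it does not matter which sides belong to the rectangle. *)
Lemma prob_rect (R : realType) (F : probability (plane R) R) (x x' y y' : \bar R) :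
  admissible F -> (x <= x')%E -> (y <= y')%E ->
  measurable (rect x x' y y') /\
  F (rect x x' y y') = ((mcdf F ax1 x' - mcdf F ax1 x) *
                        (mcdf F ax2 y' - mcdf F ax2 y))%:E.
Proof.
move=> adm xx yy; have [_ ind] := adm.
have mI (a b : \bar R) : measurable [set u : measurableTypeR R | (a <= u%:E <= b)%E].
  rewrite (_ : [set u | _] = [set u | (a <= u%:E)%E] `&` [set u | (u%:E <= b)%E]).
    by apply: measurableI; rewrite -[[set u | _]]setTI; apply: emeasurable_fun_le => //;
       exact: measurable_EFin.
  by apply/seteqP; split=> p /= => [/andP//|[-> ->]].
have -> : rect x x' y y' = [set u | (x <= u%:E <= x')%E] `*` [set u | (y <= u%:E <= y')%E].
  by [].
split; first exact: measurableX.
rewrite ind// EFinM; congr (_ * _)%E.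
  rewrite -(slab_cc F _ (measurable_ax1 R) (continuous_mcdf1 _ _ adm) _ _ xx).2.
  by congr (F _); apply/seteqP; split=> p /= => [[]|].
rewrite -(slab_cc F _ (measurable_ax2 R) (continuous_mcdf2 _ _ adm) _ _ yy).2.
by congr (F _); apply/seteqP; split=> p /= => [[]|].
Qed.

Lemma rect_subset (R : realType) (s s' t t' : R) (x x' y y' : \bar R) :
  s <= s' -> t <= t' ->
  rect s%:E s'%:E t%:E t'%:E `<=` rect x x' y y' <->
  ((x <= s%:E)%E && (s'%:E <= x')%E) && ((y <= t%:E)%E && (t'%:E <= y')%E).
Proof.
move=> ss tt; split=> [sub|/andP[/andP[xs sx] /andP[yt ty]]].
  have [] : rect x x' y y' (s, t) by apply: sub; rewrite /rect/= !lee_fin !lexx ss tt.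
  have [] : rect x x' y y' (s', t') by apply: sub; rewrite /rect/= !lee_fin !lexx ss tt.
  by move=> /= /andP[_ ->] /andP[_ ->] /andP[-> _] /andP[-> _].
move=> p /= [/andP[a1 a2] /andP[b1 b2]]; split; apply/andP; split.
- exact: le_trans xs a1.
- exact: le_trans a2 sx.
- exact: le_trans yt b1.
- exact: le_trans b2 ty.
Qed.

(** * The approximating family and its cardinality *)

Definition lg (N : nat) : nat := trunc_log 2 N.

(** Rounding the square root of [lg N] up to a power of two. *)
Definition scale (N : nat) : nat := 2 ^ up_log 4 (lg N).

(** Rectangles whose levels add up to more than this have a mass below [lg N / N],
    outside of the range where an approximation is asked for. *)
Definition depth (N : nat) : nat := trunc_log 2 (N %/ lg N).

(** The number of grid cells of level [j]: an interval of mass about [2 ^ (- j)]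
    is cut into about [16 * scale N] of them. *)
Definition pieces (N j : nat) : nat := 2 ^ j * (16 * scale N).
Definition spacing (N j : nat) : nat := N %/ pieces N j.

(** Pairs of ranks of the ends of an interval. The ranges of [i] and [e] do not
    depend on the sample, so that the count of pairs is immediate; ranks beyond
    [N] do occur among them. *)
Definition sides (N j : nat) : seq (nat * nat) :=
  [seq ((i * spacing N j)%N, ((i + e) * spacing N j)%N)
     | i <- iota 0 (2 * pieces N j).+1, e <- iota 0 (64 * scale N).+1].

Definition levels (N : nat) : seq (nat * nat) :=
  [seq (j, l) | j <- iota 0 (depth N).+1, l <- iota 0 (depth N - j).+1].

Definition rank_boxes (N : nat) : seq ((nat * nat) * (nat * nat)) :=
  flatten [seq [seq (u, v) | u <- sides N jl.1, v <- sides N jl.2]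
          | jl <- levels N].

Section counting.
Local Open Scope nat_scope.

Lemma lg_gt0 N : 2 <= N -> 0 < lg N.
Proof. by move=> N2; rewrite /lg trunc_log_gt0. Qed.

Lemma expn_lg N : 0 < N -> 2 ^ lg N <= N < 2 ^ (lg N).+1.
Proof. by move=> N0; rewrite trunc_logP ?trunc_log_ltn. Qed.

Lemma lg_le N : lg N <= N.
Proof.
case: N => // N; have /andP[h _] := expn_lg N.+1 isT.
by apply: leq_trans h; apply: ltnW; exact: ltn_expl.
Qed.

Lemma scale_gt0 N : 0 < scale N. Proof. by rewrite expn_gt0. Qed.

Lemma pieces_gt0 N j : 0 < pieces N j.
Proof. by rewrite !muln_gt0 expn_gt0 scale_gt0. Qed.

Lemma scale_sqr N : 0 < lg N -> lg N <= scale N ^ 2 <= 4 * lg N.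
Proof.
move=> l0; have sE : scale N ^ 2 = 4 ^ up_log 4 (lg N).
  by rewrite /scale -expnM mulnC expnM.
rewrite sE up_logP//=.
have [l1|l1] := leqP (lg N) 1.
  have -> : up_log 4 (lg N) = 0 by apply/eqP; rewrite up_log_eq0 l1.
  by rewrite expn0; lia.
have := up_log_gtn (isT : 1 < 4) l1.
have : 0 < up_log 4 (lg N) by rewrite up_log_gt0.
case: (up_log 4 (lg N)) => // u _ /= h; rewrite expnS leq_mul2l/=; exact: ltnW.
Qed.

Lemma expn_depth N : 2 <= N -> 2 ^ depth N * lg N <= N.
Proof.
move=> N2; have l0 := lg_gt0 _ N2.
rewrite -leq_divRL// /depth trunc_logP// divn_gt0//; exact: lg_le.
Qed.

Lemma mem_sides N j i e : 0 < spacing N j -> i * spacing N j <= N ->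
  e <= 64 * scale N ->
  ((i * spacing N j)%N, ((i + e) * spacing N j)%N) \in sides N j.
Proof.
move=> k0 iN eK.
rewrite /sides.
apply: (@allpairs_f _ _ _ (fun i e => ((i * spacing N j)%N, ((i + e) * spacing N j)%N)));
  rewrite mem_iota/= add0n ltnS//.
rewrite -(leq_pmul2r k0); apply: leq_trans iN _.
have := ltn_ceil N (pieces_gt0 N j); rewrite -/(spacing N j) => h.
nia.
Qed.

Lemma mem_levels N j l : j + l <= depth N -> (j, l) \in levels N.
Proof.
move=> jl; rewrite /levels.
apply/allpairsPdep; exists j, l; rewrite !mem_iota/= !add0n !ltnS; split=> //; lia.
Qed.

Lemma mem_rank_boxes N jl u v : jl \in levels N ->
  u \in sides N jl.1 -> v \in sides N jl.2 -> (u, v) \in rank_boxes N.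
Proof.
move=> jlN uN vN; apply/flattenP.
exists [seq (u, v) | u <- sides N jl.1, v <- sides N jl.2].
  by apply/mapP; exists jl.
by apply: allpairs_f.
Qed.

(** [3120 = 48 * 65]: there are at most [3 * pieces N j = 48 * 2 ^ j * scale N]
    left ends and at most [65 * scale N] lengths. *)
Lemma size_sides N j : size (sides N j) <= 2 ^ j * (3120 * scale N ^ 2).
Proof.
rewrite /sides size_allpairs !size_iota.
have p0 := pieces_gt0 N j; have s0 := scale_gt0 N.
apply: (@leq_trans ((3 * pieces N j) * (65 * scale N))).
  by apply: leq_mul; lia.
by rewrite /pieces; apply/eq_leq; nia.
Qed.

Lemma sum_expn2 n : \sum_(0 <= i < n) 2 ^ i <= 2 ^ n.
Proof.
elim: n => [|n IH]; first by rewrite big_nil.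
by rewrite big_nat_recr//= expnS mul2n -addnn leq_add2r.
Qed.

(** For fixed [j] the geometric sum over [l] is dominated by its last term, where
    [j + l = depth N]; all values of [j] then contribute equally. *)
Lemma size_rank_boxes_depth N :
  size (rank_boxes N) <=
    ((3120 * scale N ^ 2) * (3120 * scale N ^ 2)) *
    ((depth N).+1 * 2 ^ (depth N).+1).
Proof.
set B := 3120 * scale N ^ 2; set M := depth N.
rewrite /rank_boxes size_flatten /shape -map_comp sumnE big_map.
apply: (@leq_trans (\sum_(jl <- levels N) (B * B) * 2 ^ (jl.1 + jl.2))).
  apply: leq_sum => -[j l] _; rewrite /comp size_allpairs.
  apply: (leq_trans (leq_mul (size_sides N j) (size_sides N l))).
  by rewrite -/B expnD mulnACA mulnC.
rewrite -big_distrr /= leq_mul2l; apply/orP; right.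
have -> : \sum_(jl <- levels N) 2 ^ (jl.1 + jl.2) =
    \sum_(j <- iota 0 M.+1) \sum_(l <- iota 0 (M - j).+1) 2 ^ (j + l).
  by rewrite /levels big_allpairs_dep.
apply: (@leq_trans (\sum_(j <- iota 0 M.+1) 2 ^ M.+1)); last first.
  by rewrite big_const_seq count_predT size_iota iter_addn_0 mulnC.
rewrite big_seq [leqRHS]big_seq; apply: leq_sum => j; rewrite mem_iota add0n ltnS => jM.
under eq_bigr do rewrite expnD.
rewrite -big_distrr -[M.+1](subnK (leqW jM)) addnC expnD leq_mul2l.
by rewrite subSn// -[iota 0 _]/(index_iota 0 (M - j).+1) sum_expn2 orbT.
Qed.

Lemma size_rank_boxes N : 2 <= N ->
  size (rank_boxes N) <= (3120 * 3120) * (64 * (N * lg N ^ 2)).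
Proof.
move=> N2; have l0 := lg_gt0 _ N2.
apply: leq_trans (size_rank_boxes_depth N) _.
have /andP[_ s4] := scale_sqr _ l0.
have Nd := expn_depth _ N2.
have dl : depth N <= lg N by apply: leq_trunc_log; exact: leq_div.
have -> : (3120 * scale N ^ 2) * (3120 * scale N ^ 2) =
  (3120 * 3120) * (scale N ^ 2 * scale N ^ 2) by rewrite mulnACA.
rewrite -mulnA leq_mul2l; apply/orP; right.
apply: (@leq_trans ((4 * lg N * (4 * lg N)) * ((2 * lg N) * (2 * 2 ^ depth N)))).
  apply: leq_mul; first exact: leq_mul.
  by apply: leq_mul; [lia|rewrite expnS].
have -> : 4 * lg N * (4 * lg N) * (2 * lg N * (2 * 2 ^ depth N)) =
  64 * ((2 ^ depth N * lg N) * lg N ^ 2) by ring.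
by rewrite leq_mul2l/= leq_mul2r Nd orbT.
Qed.

End counting.

(** Strict inequalities discard the degenerate boxes that ties in the sample or
    ranks out of range may produce. *)
Definition approximants {R : realType} (N : nat)
    (mu : set (plane R) -> \bar R) : set (set (plane R)) :=
  [set Q | exists uv, [/\ uv \in rank_boxes N,
     quantile ax1 N mu uv.1.1 < quantile ax1 N mu uv.1.2,
     quantile ax2 N mu uv.2.1 < quantile ax2 N mu uv.2.2 &
     Q = rect (quantile ax1 N mu uv.1.1)%:E (quantile ax1 N mu uv.1.2)%:E
              (quantile ax2 N mu uv.2.1)%:E (quantile ax2 N mu uv.2.2)%:E]].

Lemma approximants_rectangles (R : realType) N (mu : set (plane R) -> \bar R) :
  approximants N mu `<=` @rectangles R.
Proof.
move=> Q [uv [_ h1 h2 ->]]; do 4 eexists; split; last by []; by rewrite lte_fin.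
Qed.

Lemma ln2_ge (R : realType) : 1 / 2 <= ln (2 : R).
Proof.
have := @le_ln1Dx R (- (1/2)).
have -> : 1 + - (1 / 2) = 2^-1 :> R by lra.
by rewrite lnV ?posrE// => /(_ _); lra.
Qed.

Lemma lg_ln (R : realType) N : (2 <= N)%N -> (lg N)%:R <= 2 * ln (N%:R : R).
Proof.
move=> N2.
have ln2 := ln2_ge R.
have /andP[h _] := expn_lg N (ltnW N2).
have : ln (2 ^+ lg N : R) <= ln N%:R.
  by rewrite ler_ln ?posrE ?exprn_gt0// ?ltr0n 1?ltnW// -natrX ler_nat.
rewrite lnXn//; have := ler0n R (lg N); rewrite -mulr_natr; nra.
Qed.

Lemma card_approximants (R : realType) N (mu : set (plane R) -> \bar R) :
  (2 <= N)%N ->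
  finite_set (approximants N mu) /\
  (#|` fset_set (approximants N mu)|)%:R
     <= (3120 * 3120 * 256) * N%:R * ln (N%:R : R) ^+ 2.
Proof.
move=> N2.
pose f (uv : (nat * nat) * (nat * nat)) :=
  rect (quantile ax1 N mu uv.1.1)%:E (quantile ax1 N mu uv.1.2)%:E
       (quantile ax2 N mu uv.2.1)%:E (quantile ax2 N mu uv.2.2)%:E.
have sub : approximants N mu `<=` [set` [fset Q in map f (rank_boxes N)]%fset].
  by move=> Q [uv [uvN _ _ ->]] /=; rewrite !inE; exact: (map_f f uvN).
have fin : finite_set (approximants N mu) by apply: sub_finite_set sub _.
split=> //.
apply: (@le_trans _ _ ((3120 * 3120) * (64 * (N%:R * (lg N)%:R ^+ 2)))).
  apply: (@le_trans _ _ (size (rank_boxes N))%:R).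
    rewrite ler_nat; apply: (@leq_trans #|` [fset Q in map f (rank_boxes N)]%fset|).
      apply: fsubset_leq_card; apply/fsubsetP => Q.
      by rewrite in_fset_set// inE => /sub.
    by rewrite card_fseq (leq_trans (size_undup _))// size_map.
  apply: (@le_trans _ _ ((3120 * 3120) * (64 * (N * lg N ^ 2)))%N%:R).
    by rewrite ler_nat; exact: size_rank_boxes.
  by rewrite !natrM.
have := @lg_ln R N N2; have := ler0n R (lg N); have N0 := ler0n R N.
set l := (lg N)%:R; set L := ln _ => l0 lL.
have : l ^+ 2 <= (2 * L) ^+ 2 by rewrite lerXn2r// nnegrE//; lra.
by move=> h; nra.
Qed.

(** * Measurability of the approximation event *)

Lemma measurable_bool_set d (T : measurableType d) (b : T -> bool) :
  measurable_fun setT b -> measurable [set w | b w].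
Proof.
move=> mb; rewrite -[[set w | b w]]setTI.
have -> : setT `&` [set w | b w] = setT `&` b @^-1` [set true].
  by apply/seteqP; split=> w.
by apply: mb => //; exact: measurableT.
Qed.

Lemma measurable_hits_ge d (T : measurableType d) (R : realType) (T' : Type)
    (N : nat) (X : 'I_N -> T -> T') (A : set T') (r : nat) :
  (forall i, measurable (X i @^-1` A)) ->
  measurable [set w | (r <= hits (X ^~ w) A)%N].
Proof.
move=> mE; have -> : [set w | (r <= hits (X ^~ w) A)%N] =
    [set w | (r%:R : R) <= \sum_(i < N) \1_(X i @^-1` A) w].
  by apply/seteqP; split=> w /=; rewrite -(ler_nat R) /hits natr_sum => /le_trans; apply;
     apply: ler_sum => i _; rewrite indicE.
apply: measurable_bool_set; apply: measurable_fun_ler => //.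
by apply: measurable_sum => i; exact: measurable_indic.
Qed.

(** An order statistic exceeds [t] unless enough sample points are below [t]. *)
Lemma measurable_quantile d (T : measurableType d) (R : realType)
    (pi : plane R -> R) (N : nat) (X : 'I_N -> T -> plane R) (r : nat) :
  (0 < N)%N -> measurable_fun setT pi -> (forall i, measurable_fun setT (X i)) ->
  measurable_fun setT
    (fun w => quantile pi N (empirical_measure (X ^~ w)) r).
Proof.
move=> N0 mpi mX.
(* For a rank out of range the value is the same default for all samples. *)
have [->|r0] := posnP r.
  rewrite (_ : (fun w => _) = cst (inf [set: R])) //.
  apply/funext => w; rewrite /quantile /=; congr inf.
  by apply/seteqP; split=> // t _ /=; rewrite empirical_hits lee_fin mul0r divr_ge0.
have [rN|Nr] := leqP r N; last first.
  rewrite (_ : (fun w => _) = cst (inf (@set0 R))) //.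
  apply/funext => w; rewrite /quantile /=; congr inf.
  apply/seteqP; split=> // t /=.
  rewrite empirical_hits lee_fin ler_pM2r ?invr_gt0 ?ltr0n// ler_nat.
  by rewrite leqNgt => /negP; apply; apply: leq_ltn_trans (hits_le_size _ _ _ _) Nr.
apply: (measurability _ (RGenOInfty.measurableE R)) => /= _ [_] [t ->] <-.
rewrite setTI.
have -> : (fun w => quantile pi N (empirical_measure (X ^~ w)) r) @^-1` `]t, +oo[ =
   ~` [set w | (r <= hits (X ^~ w) (below pi t%:E))%N].
  by apply/seteqP; split=> w /=; rewrite in_itv/= andbT ltNge quantileP ?r0// => /negP.
apply: measurableC; apply: (@measurable_hits_ge _ _ R) => i.
rewrite -[_ @^-1` _]setTI; apply: mX => //.
exact: measurable_below.
Qed.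

Lemma symdiff_rect (R : realType) (F : probability (plane R) R) (Q : set (plane R))
    (x x' y y' : \bar R) (m : R) :
  admissible F -> measurable Q -> F Q = m%:E -> (x <= x')%E -> (y <= y')%E ->
  rect x x' y y' `<=` Q ->
  F (Q `+` rect x x' y y') =
  (m - (mcdf F ax1 x' - mcdf F ax1 x) * (mcdf F ax2 y' - mcdf F ax2 y))%:E.
Proof.
move=> adm mQ FQ xx yy sub.
have [mr Fr] := prob_rect _ _ _ _ _ _ adm xx yy.
have -> : Q `+` rect x x' y y' = Q `\` rect x x' y y'.
  rewrite /setY (_ : rect x x' y y' `\` Q = set0) ?setU0//.
  by apply/seteqP; split=> // p [/sub].
rewrite measureD//; last by rewrite -ge0_fin_numE// fin_num_measure.
by rewrite setIidr// EFinB; congr (_ - _)%E.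
Qed.

(** A finite union over the boxes of ranks. Inclusion in [Q] and the loss of mass
    only involve the four corners of the box, through the marginal distribution
    functions. *)
Lemma measurable_approx_event (R : realType) (N : nat)
    (F : probability (plane R) R) (Q : set (plane R)) (d : measure_display)
    (T : measurableType d) (P : probability T R) (X : 'I_N -> T -> plane R) :
  (2 <= N)%N -> admissible F -> rectangles Q -> iid_sample F P X ->
  measurable (approx_event F approximants Q X).
Proof.
move=> N2 adm [x [x' [y [y' [xx yy ->]]]]] [mX _ _].
have N0 : (0 < N)%N by exact: ltnW.
have [mQ FQ] := prob_rect _ _ _ _ _ _ adm (ltW xx) (ltW yy).
set Q0 := rect x x' y y' in mQ FQ *; set m := (_ * _ : R) in FQ.
pose c : R := 9 / 8 * (fine (F Q0) /
             Num.sqrt (Num.floor (log2 (1 / fine (F Q0))))%:~R).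
pose q1 r w := quantile ax1 N (empirical_measure (X ^~ w)) r.
pose q2 r w := quantile ax2 N (empirical_measure (X ^~ w)) r.
have mq1 r : measurable_fun setT (q1 r) by exact: measurable_quantile (measurable_ax1 R) mX.
have mq2 r : measurable_fun setT (q2 r) by exact: measurable_quantile (measurable_ax2 R) mX.
have mG1 r : measurable_fun setT (fun w => mcdf F ax1 (q1 r w)%:E).
  apply: (measurableT_comp (f := fun t : R => mcdf F ax1 t%:E)) => //.
  exact: continuous_measurable_fun (continuous_mcdf1 _ _ adm).
have mG2 r : measurable_fun setT (fun w => mcdf F ax2 (q2 r w)%:E).
  apply: (measurableT_comp (f := fun t : R => mcdf F ax2 t%:E)) => //.
  exact: continuous_measurable_fun (continuous_mcdf2 _ _ adm).
pose ok (uv : (nat * nat) * (nat * nat)) w :=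
  [&& q1 uv.1.1 w < q1 uv.1.2 w, q2 uv.2.1 w < q2 uv.2.2 w,
      (x <= (q1 uv.1.1 w)%:E)%E && ((q1 uv.1.2 w)%:E <= x')%E,
      (y <= (q2 uv.2.1 w)%:E)%E && ((q2 uv.2.2 w)%:E <= y')%E &
      m - (mcdf F ax1 (q1 uv.1.2 w)%:E - mcdf F ax1 (q1 uv.1.1 w)%:E) *
          (mcdf F ax2 (q2 uv.2.2 w)%:E - mcdf F ax2 (q2 uv.2.1 w)%:E) <= c].
rewrite (_ : approx_event _ _ _ _ =
    \bigcup_(uv in [set` rank_boxes N]) [set w | ok uv w]); last first.
  apply/seteqP; split=> w.
    move=> [Q' [[uv [uvN h1 h2 ->]] sub FD]]; exists uv => //=.
    have := (rect_subset _ _ _ _ _ _ _ _ _ (ltW h1) (ltW h2)).1 sub.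
    move=> /andP[hx hy]; rewrite /ok; apply/and5P; split=> //.
    rewrite -lee_fin; apply: le_trans FD.
    by rewrite (symdiff_rect _ _ _ _ _ _ _ _ adm mQ FQ)// lee_fin ltW.
  move=> [uv uvN] /and5P[h1 h2 hx hy FD].
  exists (rect (q1 uv.1.1 w)%:E (q1 uv.1.2 w)%:E (q2 uv.2.1 w)%:E (q2 uv.2.2 w)%:E).
  have sub : rect (q1 uv.1.1 w)%:E (q1 uv.1.2 w)%:E (q2 uv.2.1 w)%:E (q2 uv.2.2 w)%:E `<=` Q0.
    by apply/(rect_subset _ _ _ _ _ _ _ _ _ (ltW h1) (ltW h2)); rewrite hx hy.
  split=> //; first by exists uv.
  by rewrite (symdiff_rect _ _ _ _ _ _ _ _ adm mQ FQ)// lee_fin// ltW.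
apply: fin_bigcup_measurable; first exact: finite_seq.
move=> uv _; apply: measurable_bool_set; rewrite /ok.
have mE f : measurable_fun [set: T] f -> measurable_fun setT (fun w => (f w)%:E : \bar R).
  by move=> mf; exact/measurable_EFinP.
apply: measurable_and; first exact: measurable_fun_ltr.
apply: measurable_and; first exact: measurable_fun_ltr.
apply: measurable_and.
  by apply: measurable_and; apply: measurable_fun_lee => //; exact: mE.
apply: measurable_and.
  by apply: measurable_and; apply: measurable_fun_lee => //; exact: mE.
apply: measurable_fun_ler => //; apply: measurable_funB => //.
by apply: measurable_funM; apply: measurable_funB.
Qed.

(** * Probability of the approximation event *)

(** One axis of the approximation. The interval from [a] to [b], of mass [w], has
    a strip of mass [w / (4 s)] at each end, bounded inside by [z] and [z']. Outside
    [B] the counts of both strips and of the whole interval are within a factor 2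
    of their expectations, so that [bracket] applies. *)
Lemma side_bracketed (R : realType) (F : probability (plane R) R)
    (d : measure_display) (T : measurableType d) (P : probability T R) (N : nat)
    (X : 'I_N -> T -> plane R) (pi : plane R -> R) (a b : \bar R) (s : nat) :
  let G t := mcdf F pi t in
  let w := G b - G a in
  let q t r := quantile pi N (empirical_measure (X ^~ t)) r in
  iid_sample F P X -> measurable_fun setT pi -> continuous (fun t : R => G t%:E) ->
  (a < b)%E -> 0 < w -> (0 < s)%N -> (0 < N)%N ->
  exists B : set T, [/\ measurable B, (P B <= (48 * s%:R / (N%:R * w))%:E)%E &
    forall t, ~ B t -> forall k K : nat, (0 < k)%N ->
      k%:R <= N%:R * w / (8 * s%:R) -> 2 * (N%:R * w) <= (K * k)%:R ->
      exists i e : nat, [/\ (i * k <= N)%N, (e <= K)%N,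
        q t (i * k)%N < q t ((i + e) * k)%N,
        (a <= (q t (i * k)%N)%:E)%E /\ ((q t ((i + e) * k)%N)%:E <= b)%E &
        w - w / (2 * s%:R) <=
          G (q t ((i + e) * k)%N)%:E - G (q t (i * k)%N)%:E]].
Proof.
move=> G w q iid mpi cG ab w0 s0 N0.
have s1 : 1 <= s%:R :> R by rewrite ler1n.
have NR : 0 < N%:R :> R by rewrite ltr0n.
(* The factor 4 leaves a gap between [z] and [z'] even for [s = 1]. *)
pose g := w / (4 * s%:R).
have g0 : 0 < g by apply: divr_gt0 => //; lra.
have g4 : 4 * g <= w.
  have -> : 4 * g = w / s%:R by rewrite /g; field; rewrite gt_eqF//; lra.
  by rewrite ler_pdivrMr; nra.
have Ga : 0 <= G a by rewrite -(mcdfNy F pi) mcdf_mono// leNye.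
have Gb : G b <= 1 by rewrite -(mcdfy F pi) mcdf_mono// leey.
have [z Gz] : exists z : R, G z%:E = G a + g.
  by apply: mcdf_surj => //; rewrite /w in g4 *; apply/andP; split; lra.
have [z' Gz'] : exists z' : R, G z'%:E = G b - g.
  by apply: mcdf_surj => //; rewrite /w in g4 *; apply/andP; split; lra.
have Glt u v : G u < G v -> (u < v)%E.
  by apply: contraTT; rewrite -!leNgt => vu; exact: (mcdf_mono F pi mpi _ _ vu).
have zz' : z < z' by rewrite -lte_fin; apply: Glt; rewrite Gz Gz' /w in g4 *; lra.
have az : (a <= z%:E)%E by apply/ltW/Glt; rewrite Gz; lra.
have zb : (z'%:E <= b)%E by apply/ltW/Glt; rewrite Gz'; lra.
have [m1 P1] := slab_oc F _ mpi _ _ az.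
have [m2 P2] := slab_oc F _ mpi _ _ zb.
have [m3 P3] := slab_oc F _ mpi _ _ (ltW ab).
have E1 : mcdf F pi z%:E - mcdf F pi a = g by rewrite -/(G _) Gz -/(G a); lra.
have E2 : mcdf F pi b - mcdf F pi z'%:E = g by rewrite -/(G z'%:E) Gz' -/(G b); lra.
rewrite E1 in P1; rewrite E2 in P2; rewrite -/(G a) -/(G b) -/w in P3.
have Ng0 : 0 < N%:R * g by rewrite mulr_gt0.
have Nw0 : 0 < N%:R * w by rewrite mulr_gt0.
have [B1 [mB1 PB1 good1]] := iid_concentration _ _ _ _ _ _ _ _ _ iid m1 P1 Ng0.
have [B2 [mB2 PB2 good2]] := iid_concentration _ _ _ _ _ _ _ _ _ iid m2 P2 Ng0.
have [B3 [mB3 PB3 good3]] := iid_concentration _ _ _ _ _ _ _ _ _ iid m3 P3 Nw0.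
exists (B1 `|` (B2 `|` B3)); split.
- by apply: measurableU => //; exact: measurableU.
- apply: (le_trans (measureU2 _ _ _)) => //; first exact: measurableU.
  apply: (le_trans (leeD2l _ (measureU2 _ _ _))) => //.
  apply: (le_trans (leeD PB1 (leeD PB2 PB3))).
  rewrite -!EFinD lee_fin.
  have -> : 48 * s%:R / (N%:R * w) = 3 * (4 / (N%:R * g)).
    by rewrite /g; field; rewrite !gt_eqF//; lra.
  have : 4 / (N%:R * w) <= 4 / (N%:R * g).
    by rewrite ler_pM2l// lef_pV2 ?posrE// ler_pM2l//; lra.
  lra.
- move=> t /not_orP[nB1 /not_orP[nB2 nB3]] k K k0 kN NK.
  have /andP[h1 _] := good1 _ nB1; have /andP[h2 _] := good2 _ nB2.
  have /andP[_ h3] := good3 _ nB3.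
  have kg : k%:R <= N%:R * g / 2.
    apply: le_trans kN _; rewrite /g le_eqVlt; apply/orP; left; apply/eqP.
    by field; rewrite gt_eqF//; lra.
  have [|||i [e [iN eK [aq qz] [zq qb]]]] :=
    bracket _ pi N (X ^~ t) k K a b z z' k0 (ltW zz').
  + by rewrite (hits_slab _ _ _ _ (X ^~ t) _ _ az) leq_add2l -(ler_nat R); lra.
  + by rewrite (hits_slab _ _ _ _ (X ^~ t) _ _ zb) leq_add2l -(ler_nat R); lra.
  + by rewrite (hits_slab _ _ _ _ (X ^~ t) _ _ (ltW ab)) leq_add2l -(ler_nat R); lra.
  exists i, e; split=> //.
    by apply: le_lt_trans qz _; apply: lt_le_trans zz' zq.
  have u1 : G (q t (i * k)%N)%:E <= G z%:E by apply: mcdf_mono => //; rewrite lee_fin.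
  have u2 : G z'%:E <= G (q t ((i + e) * k)%N)%:E by apply: mcdf_mono => //; rewrite lee_fin.
  have -> : w / (2 * s%:R) = 2 * g by rewrite /g; field; rewrite gt_eqF//; lra.
  rewrite Gz in u1; rewrite Gz' in u2; rewrite /w; lra.
Qed.

Lemma dyadic_level (R : realType) (w : R) : 0 < w <= 1 ->
  exists j : nat, 2 ^+ j * w <= 1 < 2 ^+ j.+1 * w.
Proof.
move=> /andP[w0 w1].
have w1' : 1 <= w^-1 by rewrite invf_ge1.
have [n1 n2] : (Num.truncn w^-1)%:R <= w^-1 /\ w^-1 < (Num.truncn w^-1).+1%:R.
  by split; [rewrite truncn_le; lra|exact: truncnS_gt].
have n0 : (0 < Num.truncn w^-1)%N by rewrite truncn_gt0.
exists (trunc_log 2 (Num.truncn w^-1)); apply/andP; split.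
  rewrite -ler_pdivlMr// div1r; apply: le_trans n1.
  by rewrite -natrX ler_nat trunc_logP.
rewrite -ltr_pdivrMr// div1r; apply: lt_le_trans n2 _.
by rewrite -natrX ler_nat trunc_log_ltn.
Qed.

(** The spacing of the grid whose level is the order of magnitude of [w] is at most
    half of the expected count of a strip of mass [w / (4 * scale N)], and
    [64 * scale N] of its steps cover twice the expected count of an interval of mass [w]. *)
Lemma spacing_bounds (R : realType) (N j : nat) (w : R) :
  (0 < N)%N -> 0 < w -> 2 ^+ j * w <= 1 < 2 ^+ j.+1 * w ->
  16 * (scale N)%:R <= N%:R * w ->
  [/\ (0 < spacing N j)%N,
      (spacing N j)%:R <= N%:R * w / (8 * (scale N)%:R) &
      2 * (N%:R * w) <= (64 * scale N * spacing N j)%:R].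
Proof.
move=> N0 w0 /andP[jw wj] sN.
have NR : 0 < N%:R :> R by rewrite ltr0n.
have S0 : 0 < (scale N)%:R :> R by rewrite ltr0n scale_gt0.
have p0 : 0 < 2 ^+ j :> R by rewrite exprn_gt0.
have pE : (pieces N j)%:R = 2 ^+ j * (16 * (scale N)%:R) :> R.
  by rewrite /pieces !natrM natrX.
have k0 : (0 < spacing N j)%N.
  rewrite divn_gt0 ?pieces_gt0// -(ler_nat R) pE.
  by apply: (le_trans (ler_wpM2l (ltW p0) sN)); nra.
have kN : (spacing N j)%:R * (2 ^+ j * (16 * (scale N)%:R)) <= N%:R :> R.
  by rewrite -pE -natrM ler_nat leq_trunc_div.
have Nk : N%:R <= 2 * (spacing N j)%:R * (2 ^+ j * (16 * (scale N)%:R)) :> R.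
  rewrite -pE -!natrM ler_nat.
  by have := ltn_ceil N (pieces_gt0 N j); rewrite -/(spacing N j); nia.
split=> //.
- rewrite ler_pdivlMr; last by rewrite mulr_gt0.
  rewrite exprS in wj.
  move: kN wj; set k := (spacing N j)%:R; set p := 2 ^+ j; set S := (scale N)%:R => kN wj.
  have k1 : 0 <= k by exact: ler0n.
  have : k * (p * (16 * S)) * w <= N%:R * w by rewrite ler_pM2r.
  have : k * (8 * S) * 1 <= k * (8 * S) * (2 * p * w).
    by apply: ler_wpM2l; [apply: mulr_ge0; lra|exact: ltW].
  lra.
- rewrite !natrM.
  move: Nk jw; set k := (spacing N j)%:R; set p := 2 ^+ j; set S := (scale N)%:R => Nk jw.
  have k1 : 0 <= k by exact: ler0n.
  have : N%:R * w <= 2 * k * (p * (16 * S)) * w by rewrite ler_pM2r.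
  have : k * (32 * S) * (p * w) <= k * (32 * S) * 1.
    by apply: ler_wpM2l; [apply: mulr_ge0; lra|].
  lra.
Qed.

Lemma floor_log2_bounds (R : realType) (N : nat) (m : R) :
  (2 <= N)%N -> 0 < m -> m <= 1 / 8 -> 1 <= N%:R * m ->
  0 < ((Num.floor (log2 (1 / m)))%:~R : R) <= (lg N)%:R.
Proof.
move=> N2 m0 m8 Nm.
have l0 := ln2_ge R.
have l0' : 0 < ln (2 : R) by lra.
have N0 : 0 < N%:R :> R by rewrite ltr0n; lia.
have i0 : 0 < 1 / m by apply: divr_gt0.
have h1 : 1 <= log2 (1 / m).
  rewrite /log2 ler_pdivlMr// [leLHS]mul1r ler_ln ?posrE//.
  by rewrite ler_pdivlMr//; lra.
have h2 : log2 (1 / m) < ((lg N).+1%:Z)%:~R.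
  rewrite /log2 ltr_pdivrMr// -pmulrn mulr_natl -lnXn//.
  rewrite ltr_ln ?posrE// ?exprn_gt0//.
  apply: (@le_lt_trans _ _ N%:R); first by rewrite ler_pdivrMr.
  by rewrite -natrX ltr_nat; have /andP[] := expn_lg N (ltnW N2).
apply/andP; split.
  by rewrite ltr0z gtz0_ge1 floor_ge_int.
rewrite -[(lg N)%:R]/((lg N)%:Z%:~R) ler_int.
by rewrite -ltzD1 floor_lt_int; have -> : (lg N)%:Z + 1 = (lg N).+1%:Z by lia.
Qed.

(** Shrinking both factors by [1 - 1 / (2 s)] shrinks the product by at least
    [1 - 1 / s], which leaves room below the factor [9 / 8]. *)
Lemma shrink_loss (R : realType) (w h s f A B : R) :
  0 < w -> 0 < h -> 1 <= s -> 0 < f <= s ^+ 2 ->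
  w - w / (2 * s) <= A -> h - h / (2 * s) <= B ->
  w * h - A * B <= 9 / 8 * (w * h / Num.sqrt f).
Proof.
move=> w0 h0 s1 /andP[f0 fs] wA hB.
have m0 : 0 < w * h by exact: mulr_gt0.
have s0 : 0 < s by lra.
have sq0 : 0 < Num.sqrt f by rewrite sqrtr_gt0.
have sqs : Num.sqrt f <= s.
  by rewrite -[leRHS]ger0_norm ?(ltW s0)// -sqrtr_sqr ler_sqrt// sqr_ge0.
apply: (@le_trans _ _ (w * h / Num.sqrt f)); last first.
  by have := divr_gt0 m0 sq0; lra.
apply: (@le_trans _ _ (w * h / s)); last by rewrite ler_pM2l// lef_pV2.
pose c := 1 / (2 * s).
have c0 : 0 < c by apply: divr_gt0; lra.
have c1 : c <= 1 / 2 by rewrite ler_pdivrMr; lra.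
have wE : w - w / (2 * s) = w * (1 - c) by rewrite /c; lra.
have hE : h - h / (2 * s) = h * (1 - c) by rewrite /c; lra.
rewrite {}wE in wA; rewrite {}hE in hB.
have AB : w * (1 - c) * (h * (1 - c)) <= A * B.
  by apply: ler_pM => //; apply: mulr_ge0; lra.
have -> : w * h / s = (w * h) * (2 * c) by rewrite /c; field; rewrite gt_eqF.
by have := mulr_ge0 (ltW m0) (sqr_ge0 c); lra.
Qed.

(** Both axes satisfy [side_bracketed] outside [B]; the masses [w] and [h] are at
    least [w * h], so that each axis contributes at most [24 s / log N] to the
    probability of [B]. *)
Lemma approx_event_off_small_set (R : realType) (F : probability (plane R) R)
    (d : measure_display) (T : measurableType d) (P : probability T R) (N : nat)
    (X : 'I_N -> T -> plane R) (Q : set (plane R)) :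
  (2 <= N)%N -> admissible F -> rectangles Q -> in_range F N Q ->
  iid_sample F P X -> 48 * (scale N)%:R < ln (N%:R : R) ->
  exists B : set T, [/\ measurable B,
    (P B <= (48 * (scale N)%:R / ln (N%:R : R))%:E)%E &
    ~` B `<=` approx_event F approximants Q X].
Proof.
move=> N2 adm [x [x' [y [y' [xx yy ->]]]]] rng iid sN.
have N0 : (0 < N)%N by exact: ltnW.
have NR : 0 < N%:R :> R by rewrite ltr0n.
have [mQ FQ] := prob_rect _ _ _ _ _ _ adm (ltW xx) (ltW yy).
set w := mcdf F ax1 x' - mcdf F ax1 x in FQ.
set h := mcdf F ax2 y' - mcdf F ax2 y in FQ.
have w1 : w <= 1.
  have := mcdf_mono F _ (measurable_ax1 R) _ _ (leNye x); rewrite mcdfNy.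
  have := mcdf_mono F _ (measurable_ax1 R) _ _ (leey x'); rewrite mcdfy /w; lra.
have h1 : h <= 1.
  have := mcdf_mono F _ (measurable_ax2 R) _ _ (leNye y); rewrite mcdfNy.
  have := mcdf_mono F _ (measurable_ax2 R) _ _ (leey y'); rewrite mcdfy /h; lra.
have w0' : 0 <= w by rewrite subr_ge0 mcdf_mono ?ltW//; exact: measurable_ax1.
have h0' : 0 <= h by rewrite subr_ge0 mcdf_mono ?ltW//; exact: measurable_ax2.
move: rng; rewrite /in_range FQ !lee_fin => /andP[mlow m8].
set L := ln (N%:R : R) in sN mlow *; set s := (scale N)%:R in sN *.
have s1 : 1 <= s by rewrite /s ler1n scale_gt0.
have L48 : 48 < L by lra.
have m0 : 0 < w * h by apply: lt_le_trans mlow; apply: divr_gt0 => //; lra.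
have w0 : 0 < w by rewrite lt0r w0' andbT; apply: contraTneq m0 => ->; rewrite mul0r ltxx.
have h0 : 0 < h by rewrite lt0r h0' andbT; apply: contraTneq m0 => ->; rewrite mulr0 ltxx.
have NmL : 2 * L <= N%:R * (w * h) by move: mlow; rewrite ler_pdivrMr// [leRHS]mulrC.
have NwL : 2 * L <= N%:R * w.
  by apply: le_trans NmL _; rewrite ler_pM2l// ger_pMr.
have NhL : 2 * L <= N%:R * h.
  by apply: le_trans NmL _; rewrite ler_pM2l// ger_pMl.
have fl : 0 < ((Num.floor (log2 (1 / (w * h))))%:~R : R) <= (lg N)%:R.
  by apply: floor_log2_bounds => //; lra.
have bnd u : 2 * L <= u -> 48 * s / u <= 48 * s / (2 * L).
  move=> Lu; rewrite ler_pM2l; last by lra.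
  by rewrite lef_pV2 ?posrE; lra.
have eL : 48 * s / (2 * L) + 48 * s / (2 * L) = 48 * s / L.
  by field; rewrite gt_eqF//; lra.
have sNw : 16 * s <= N%:R * w by lra.
have sNh : 16 * s <= N%:R * h by lra.
have [B1 [mB1 PB1 good1]] := side_bracketed _ _ _ _ _ _ _ ax1 x x' _ iid (measurable_ax1 R)
  (continuous_mcdf1 _ _ adm) xx w0 (scale_gt0 N) N0.
have [B2 [mB2 PB2 good2]] := side_bracketed _ _ _ _ _ _ _ ax2 y y' _ iid (measurable_ax2 R)
  (continuous_mcdf2 _ _ adm) yy h0 (scale_gt0 N) N0.
exists (B1 `|` B2); split; first exact: measurableU.
  apply: (le_trans (measureU2 _ _ _)) => //.
  apply: (le_trans (leeD PB1 PB2)); rewrite -EFinD lee_fin -/w -/h -/s.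
  by rewrite -eL; exact: lerD (bnd _ NwL) (bnd _ NhL).
have [j jw] : exists j : nat, 2 ^+ j * w <= 1 < 2 ^+ j.+1 * w.
  by apply: dyadic_level; rewrite w0 w1.
have [l lh] : exists l : nat, 2 ^+ l * h <= 1 < 2 ^+ l.+1 * h.
  by apply: dyadic_level; rewrite h0 h1.
have [k0 k1 k2] : [/\ (0 < spacing N j)%N,
      (spacing N j)%:R <= N%:R * w / (8 * (scale N)%:R) &
      2 * (N%:R * w) <= (64 * scale N * spacing N j)%:R].
  by apply: spacing_bounds.
have [k0' k1' k2'] : [/\ (0 < spacing N l)%N,
      (spacing N l)%:R <= N%:R * h / (8 * (scale N)%:R) &
      2 * (N%:R * h) <= (64 * scale N * spacing N l)%:R].
  by apply: spacing_bounds.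
move=> t /= /not_orP[nB1 nB2].
have [i [e [iN eK q1lt [xq qx] D1]]] := good1 _ nB1 _ _ k0 k1 k2.
have [i' [e' [iN' eK' q2lt [yq qy] D2]]] := good2 _ nB2 _ _ k0' k1' k2'.
set q1 := quantile ax1 N _ in q1lt xq qx D1.
set q2 := quantile ax2 N _ in q2lt yq qy D2.
set r1 := (i * _)%N in q1lt xq qx D1; set r1' := ((i + e) * _)%N in q1lt xq qx D1.
set r2 := (i' * _)%N in q2lt yq qy D2; set r2' := ((i' + e') * _)%N in q2lt yq qy D2.
have sub : rect (q1 r1)%:E (q1 r1')%:E (q2 r2)%:E (q2 r2')%:E `<=` rect x x' y y'.
  by apply/(rect_subset _ _ _ _ _ _ _ _ _ (ltW q1lt) (ltW q2lt)); rewrite xq qx yq qy.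
exists (rect (q1 r1)%:E (q1 r1')%:E (q2 r2)%:E (q2 r2')%:E); split=> //.
  exists ((r1, r1'), (r2, r2')); split=> //.
  apply: (@mem_rank_boxes N (j, l)); [|exact: mem_sides|exact: mem_sides].
  (* [2 ^ (j + l)] is at most the inverse of [w * h], hence at most [N / lg N]. *)
  apply: mem_levels; apply: trunc_log_max => //.
  rewrite leq_divRL ?lg_gt0// -(ler_nat R) natrM natrX exprD.
  have lL := @lg_ln R N N2.
  have /andP[jw1 _] := jw; have /andP[lh1 _] := lh.
  have pj : 0 < 2 ^+ j :> R by rewrite exprn_gt0.
  have pl : 0 < 2 ^+ l :> R by rewrite exprn_gt0.
  have A : 2 ^+ j * 2 ^+ l * (w * h) <= 1.
    by rewrite mulrACA; apply: mulr_ile1 => //; rewrite mulr_ge0// ltW.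
  apply: (@le_trans _ _ (2 ^+ j * 2 ^+ l * (N%:R * (w * h)))).
    by rewrite ler_pM2l ?mulr_gt0//; exact: le_trans NmL.
  by rewrite mulrCA ger_pMr.
rewrite (symdiff_rect _ _ _ _ _ _ _ _ adm mQ FQ)//; try by rewrite lee_fin ltW.
rewrite FQ lee_fin [fine _]/=.
rewrite -/w in D1; rewrite -/h in D2; rewrite -/s in D1 D2.
apply: shrink_loss D1 D2 => //.
move: fl => /andP[-> fl]; apply: le_trans fl _; rewrite /s -natrX ler_nat.
by have /andP[] := scale_sqr N (lg_gt0 N N2).
Qed.

(** * Samples from the uniform distribution on the unit square *)

(** Induction on [N]: one more observation is a first factor in a product space. *)
Lemma iid_sample_exists (R : realType) (F : probability (plane R) R) (N : nat) :
  exists (d : measure_display) (T : measurableType d) (P : probability T R)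
    (X : 'I_N -> T -> plane R), iid_sample F P X.
Proof.
elim: N => [|N [d [T [P [X [mX XF XI]]]]]].
  exists _, (plane R), F, (fun i _ => point); split; try by case.
  move=> A mA; rewrite big_ord0 (_ : [set w | _] = setT) ?probability_setT//.
  by apply/seteqP; split=> // w _ [].
pose Y (i : 'I_N.+1) (v : plane R * T) : plane R :=
  if unlift ord0 i is Some j then X j v.2 else v.1.
have Y0 : Y ord0 = fst by apply/funext => v; rewrite /Y unlift_none.
have YS j : Y (lift ord0 j) = X j \o snd by apply/funext => v; rewrite /Y liftK.
pose PP : probability (plane R * T)%type R := (F \x P)%E.
have PPE (A : set (plane R)) (B : set T) : measurable A -> measurable B ->
  PP (A `*` B) = (F A * P B)%E by exact: product_measure1E.
have mXi j A : measurable A -> measurable (X j @^-1` A).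
  by move=> mA; rewrite -[_ @^-1` _]setTI; exact: mX.
have YF i (A : set (plane R)) : measurable A -> PP (Y i @^-1` A) = F A.
  move=> mA; case: (unliftP ord0 i) => [j|] ->.
    rewrite YS (_ : _ @^-1` _ = setT `*` (X j @^-1` A)).
      by rewrite PPE// ?probability_setT ?mul1e ?XF//; exact: mXi.
    by apply/seteqP; split=> v //= [].
  rewrite Y0 (_ : _ @^-1` _ = A `*` setT).
    by rewrite PPE// probability_setT mule1.
  by apply/seteqP; split=> v //= [].
exists _, (plane R * T)%type, PP, Y; split=> //.
  move=> i; case: (unliftP ord0 i) => [j|] ->.
    by rewrite YS; apply: measurableT_comp => //; exact: measurable_snd.
  by rewrite Y0; exact: measurable_fst.
move=> A mA.
rewrite (_ : [set w | _] = A ord0 `*` [set v | forall j, A (lift ord0 j) (X j v)]).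
  rewrite PPE//; last first.
    rewrite (_ : [set v | _] = \bigcap_(j in setT) (X j @^-1` A (lift ord0 j))).
      apply: fin_bigcap_measurable => // j _; exact: mXi.
    by apply/seteqP; split=> v /= h j; [move=> _|]; exact: h.
  rewrite (XI (fun j => A (lift ord0 j)))// big_ord_recl YF//; congr (_ * _)%E.
  by apply: eq_bigr => j _; rewrite YF// XF.
apply/seteqP; split=> v /=.
  move=> h; split; first by have := h ord0; rewrite Y0.
  by move=> j; have := h (lift ord0 j); rewrite YS.
by case=> h0 h i; case: (unliftP ord0 i) => [j|] ->; rewrite ?YS ?Y0//=.
Qed.

Lemma uniform01_ray (R : realType) (t : R) :
  uniform_prob (@ltr01 R) `]-oo, t]%classic = (Num.max 0 (Num.min t 1))%:E.
Proof.
rewrite /uniform_prob integral_uniform_pdf.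
rewrite (_ : _ `&` _ = `[0, Num.min t 1]%classic); last first.
  apply/seteqP; split=> u /=; rewrite !in_itv/= le_min.
    by move=> [ut /andP[-> ->]]; rewrite ut.
  by move=> /and3P[-> -> ->].
rewrite (eq_integral (fun=> 1%:E)); last first.
  move=> u; rewrite inE/= in_itv/= le_min => /and3P[u0 ut u1].
  by rewrite /uniform_pdf u0 u1 subr0 invr1.
rewrite integral_cst//= mul1e lebesgue_measure_itv/= lte_fin.
by rewrite maxElt; case: ifPn => // _; rewrite sube0.
Qed.

Definition unit_square (R : realType) : probability (plane R) R :=
  (uniform_prob (@ltr01 R) \x uniform_prob (@ltr01 R))%E.

Lemma unit_squareE (R : realType) (A B : set (measurableTypeR R)) :
  measurable A -> measurable B ->
  unit_square R (A `*` B) =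
  (uniform_prob (@ltr01 R) A * uniform_prob (@ltr01 R) B)%E.
Proof. by move=> mA mB; exact: product_measure1E. Qed.

Lemma admissible_unit_square (R : realType) : admissible (unit_square R).
Proof.
pose c (t : R) := Num.max 0 (Num.min t 1).
have cc : continuous c.
  move=> t; apply: (@continuous_max R R (cst 0) (id \min cst 1)).
    exact: cst_continuous.
  by apply: continuous_min; [exact: cvg_id|exact: cst_continuous].
split; last first.
  move=> A B mA mB; rewrite !unit_squareE//.
  by rewrite -[X in (_ * (X * _))%E]/(_ _) !probability_setT mule1 mul1e.
have -> : joint_cdf (unit_square R) = (fun p : R * R => c p.1 * c p.2).
  apply/funext => p; rewrite /joint_cdf unit_squareE//.
  by rewrite !uniform01_ray -EFinM.
move=> p; apply: cvgM.
  by apply: (@continuous_comp _ _ _ fst c); [exact: cvg_fst|exact: cc].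
by apply: (@continuous_comp _ _ _ snd c); [exact: cvg_snd|exact: cc].
Qed.

Lemma approx_probabilities_unit_square (R : realType) app (N : nat) :
  2 * ln (N%:R : R) / N%:R <= 1 / 8 ->
  exists (Q : set (plane R)) (d : measure_display) (T : measurableType d)
    (P : probability T R) (X : 'I_N -> T -> plane R),
  [/\ rectangles Q, in_range (unit_square R) N Q, iid_sample (unit_square R) P X &
    approx_probabilities app N (P (approx_event (unit_square R) app Q X))].
Proof.
move=> N8.
have [d [T [P [X iid]]]] := iid_sample_exists R (unit_square R) N.
pose Q : set (plane R) := rect 0%:E (1 / 8)%:E -oo +oo.
have adm := admissible_unit_square R.
have rQ : rectangles Q by exists 0%:E, (1 / 8)%:E, -oo%E, +oo%E; split=> //; rewrite lte_fin; lra.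
have G1 t : mcdf (unit_square R) ax1 t%:E = Num.max 0 (Num.min t 1).
  rewrite /mcdf (_ : below _ _ = `]-oo, t]%classic `*` setT).
    by rewrite unit_squareE// probability_setT mule1 uniform01_ray.
  by apply/seteqP; split=> p; rewrite /below/= in_itv/= lee_fin// => -[].
have FQ : unit_square R Q = (1 / 8)%:E.
  have [||_ ->] := prob_rect _ (unit_square R) 0%:E (1 / 8)%:E -oo +oo adm.
  - by rewrite lee_fin; lra.
  - by [].
  rewrite !G1 mcdfNy mcdfy ?subr0 ?mulr1; congr EFin.
  by rewrite (min_idPl _) ?(max_idPr _) ?(min_idPl _) ?(max_idPl _) ?subr0//; lra.
have rng : in_range (unit_square R) N Q by rewrite /in_range FQ !lee_fin lexx andbT.
by exists Q, d, T, P, X; split=> //; exists (unit_square R), Q, d, T, P, X.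
Qed.

(** * Convergence of the infimum *)

(** When [48 s >= log N] the bound is not positive; otherwise the grid is fine
    enough for [approx_event_off_small_set]. *)
Lemma approx_probability_ge (R : realType) (N : nat) (p : \bar R) :
  (2 <= N)%N -> approx_probabilities approximants N p ->
  ((1 - 48 * (scale N)%:R / ln (N%:R : R))%:E <= p)%E.
Proof.
move=> N2 [F [Q [d [T [P [X [adm rQ rng iid ->]]]]]]].
have mE := measurable_approx_event R N F Q d T P X N2 adm rQ iid.
have [sN|Ns] := ltP (48 * (scale N)%:R) (ln (N%:R : R)); last first.
  have L0 : 0 < ln (N%:R : R) by rewrite ln_gt0// ltr1n.
  apply: (@le_trans _ _ 0%E); last exact: measure_ge0.
  by rewrite lee_fin subr_le0 ler_pdivlMr// mul1r.
have [B [mB PB sub]] := approx_event_off_small_set R F d T P N X Q N2 adm rQ rng iid sN.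
apply: (@le_trans _ _ (P (~` B))).
  rewrite probability_setC// EFinB.
  by apply: leeB.
by rewrite le_measure ?inE//; exact: measurableC.
Qed.

(** The square of [scale N] is at most [4 lg N], hence at most [8 log N]. *)
Lemma scale_ln_cvg0 (R : realType) :
  (48 * (scale N)%:R / ln (N%:R : R)) @[N --> \oo] --> (0 : R).
Proof.
apply/cvgrPdist_le => e e0.
near=> N.
have N2 : (2 <= N)%N by near: N; exists 2%N.
set L := ln (N%:R : R); set s := (scale N)%:R.
have N0 : 0 < N%:R :> R by rewrite ltr0n; lia.
have LA : (48 / e) ^+ 2 * 8 <= L.
  rewrite -ler_expR lnK ?posrE//.
  by near: N; exact: nbhs_infty_ger.
have e48 : 0 < 48 / e by apply: divr_gt0.
have L0 : 0 < L by apply: lt_le_trans LA; rewrite mulr_gt0// exprn_gt0.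
have s0 : 0 <= s by exact: ler0n.
have sL : s ^+ 2 <= 8 * L.
  have /andP[_ h] := scale_sqr N (lg_gt0 N N2).
  have : s ^+ 2 <= 4 * (lg N)%:R by rewrite /s -natrX -natrM ler_nat.
  by have := @lg_ln R N N2; rewrite -/L; lra.
have : 48 / e * s <= L.
  have es0 : 0 <= 48 / e * s by apply: mulr_ge0 => //; exact: ltW.
  rewrite -(@ler_pXn2r _ 2)// ?nnegrE ?(ltW L0)//.
  rewrite exprMn; apply: (@le_trans _ _ ((48 / e) ^+ 2 * (8 * L))).
    by rewrite ler_wpM2l// sqr_ge0.
  by rewrite mulrA expr2 ler_wpM2r// ltW.
rewrite mulrAC ler_pdivrMr// => h.
rewrite sub0r normrN ger0_norm; last by rewrite divr_ge0 ?mulr_ge0// ltW.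
by rewrite ler_pdivrMr// [leRHS]mulrC.
Unshelve. all: by end_near. Qed.

(** [log N] is twice the logarithm of the square root of [N], which is at least 32
    here. *)
Lemma ln_over_id_small (R : realType) (N : nat) :
  (1024 <= N)%N -> 2 * ln (N%:R : R) / N%:R <= 1 / 8.
Proof.
move=> N1.
have N0 : 0 < N%:R :> R by rewrite ltr0n; lia.
pose r := Num.sqrt (N%:R : R).
have rE : r ^+ 2 = N%:R by rewrite sqr_sqrtr// ltW.
have r0 : 0 < r by rewrite sqrtr_gt0.
have r32 : 32 <= r.
  rewrite -(@ler_pXn2r _ 2)// ?nnegrE ?(ltW r0)// rE -natrX ler_nat.
  exact: leq_trans N1.
rewrite ler_pdivrMr// -rE lnXn//.
have := @ln_sublinear R r r0; rewrite -mulr_natr; nra.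
Qed.

Theorem corollary1 (R : realType) :
  exists (C' : R)
    (app : nat -> (set (plane R) -> \bar R) -> set (set (plane R))),
    [/\ forall (N : nat) (x : 'I_N -> plane R), (2 <= N)%N ->
          app N (empirical_measure x) `<=` @rectangles R,
        forall (N : nat) (F : probability (plane R) R) (Q : set (plane R))
          (d : measure_display) (T : measurableType d) (P : probability T R)
          (X : 'I_N -> T -> plane R),
          (2 <= N)%N -> admissible F -> rectangles Q -> in_range F N Q ->
          iid_sample F P X -> measurable (approx_event F app Q X),
        ereal_inf (approx_probabilities app N) @[N --> \oo] --> 1%E
      & forall (N : nat) (x : 'I_N -> plane R), (2 <= N)%N ->
          finite_set (app N (empirical_measure x)) /\
          (#|` fset_set (app N (empirical_measure x))|)%:R
            <= C' * N%:R * ln N%:R ^+ 2].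
Proof.
exists (3120 * 3120 * 256), approximants; split.
- by move=> N x _; exact: approximants_rectangles.
- by move=> N F Q d T P X N2 adm rQ _; exact: measurable_approx_event.
- apply: (@squeeze_cvge _ _ _ _
    (fun N => (1 - 48 * (scale N)%:R / ln (N%:R : R))%:E) _ (cst 1%E)); last 2 first.
  + apply: cvg_EFin; first exact: nearW.
    rewrite -[X in _ --> X]subr0; apply: cvgB; first exact: cvg_cst.
    exact: scale_ln_cvg0.
  + exact: cvg_cst.
  near=> N.
  have N1 : (1024 <= N)%N by near: N; exists 1024%N.
  have N2 : (2 <= N)%N by lia.
  apply/andP; split.
    by apply: le_ereal_inf_tmp => p; exact: approx_probability_ge.
  have [Q [d [T [P [X [rQ rng iid mem]]]]]] :=
    approx_probabilities_unit_square R approximants N (ln_over_id_small R N N1).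
  apply: le_trans (ereal_inf_lbound mem) _; apply: probability_le1.
  exact: measurable_approx_event (admissible_unit_square R) rQ iid.
- by move=> N x N2; exact: card_approximants.
Unshelve. all: by end_near. Qed.
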